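(* Let $m\ge0$, let $(\vec X^m,\kappa^m_\sigma)\in\underline V(\Gamma^m)\times V(\Gamma^m)$ be given, and let $(\boldsymbol W^{m+1},\vec X^{m+1},\kappa^{m+1}_\sigma)\in\boldsymbol S^m_\Sigma\times\underline V(\Gamma^m)\times V(\Gamma^m)$ be a solution of the nonlinear system $$\langle\nabla\boldsymbol W^{m+1},\nabla\boldsymbol\varphi\rangle_\Omega-\sum_{(i,j,k)\in\Lambda}\Big\langle\pi^h_i\Big[\tfrac{\vec X^{m+1}_i-\vec X^m_i}{\tau_m}\cdot\vec\omega^{m+\frac12}_i\Big],\varphi_j-\varphi_k\Big\rangle^{(h)}_{\Gamma^m_i}=0\quad\forall\,\boldsymbol\varphi\in\boldsymbol S^m_\Sigma,$$ $$\langle\kappa^{m+1}_\sigma,\xi\rangle^h_{\Gamma^m}-\sum_{(i,j,k)\in\Lambda}\langle W^{m+1}_j-W^{m+1}_k,\xi_i\rangle^{(h)}_{\Gamma^m_i}=0\quad\forall\,\xi\in V(\Gamma^m),$$ $$\langle\kappa^{m+1}_\sigma\vec\omega^{m+\frac12},\vec\eta\rangle^h_{\Gamma^m}+\langle\sigma\nabla_s\vec X^{m+1},\nabla_s\vec\eta\rangle_{\Gamma^m}=0\quad\forall\,\vec\eta\in\underline V(\Gamma^m),$$ where the superscript $(h)$ means that either mass lumping ($h$) is used or it is omitted, consistently in both equations where it appears. Then, for each of the two choices, $$|\Gamma^{m+1}|_\sigma+\tau_m\|\nabla\boldsymbol W^{m+1}\|_2^2\le|\Gamma^m|_\sigma,$$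 where $|\Gamma^m|_\sigma=\sum_{i=1}^3\sigma_i|\Gamma^m_i|$.
   Context: $\Omega\subset\mathbb R^2$ is a bounded domain, $\mathfrak T^m$ a triangulation of $\overline\Omega$, $S^m=\{v\in C(\overline\Omega)\mid v|_o\text{ affine }\forall o\in\mathfrak T^m\}$, and $\boldsymbol S^m_\Sigma=\{\boldsymbol\varphi=(\varphi_1,\varphi_2,\varphi_3)\in[S^m]^3\mid\varphi_1+\varphi_2+\varphi_3=0\}$. $\Lambda=\{(1,3,2),(2,1,3),(3,2,1)\}$. $\tau_m=t_{m+1}-t_m>0$ is the time step and $\sigma_1,\sigma_2,\sigma_3>0$ are surface tensions with $\sigma_1\le\sigma_2+\sigma_3$, $\sigma_2\le\sigma_1+\sigma_3$, $\sigma_3\le\sigma_1+\sigma_2$; $\sigma=\sigma_i$ on $\Gamma^m_i$. Curves. For $i=1,2,3$, $I=[0,1]$ is split as $I=\bigcup_{j=1}^{N_i}[q_{i,j-1},q_{i,j}]$ with $0=q_{i,0}<\dots<q_{i,N_i}=1$, $N_i\ge2$. $V^h_i$ is the space of continuous functions on $I$ that are affine on each $[q_{i,j-1},q_{i,j}]$, $\underline V^h_i=[V^h_i]^2$, and $\pi^h_i:C(I)\to V^h_i$ is the nodal interpolation operator. $V(\Gamma^m)=V^h_1\times V^h_2\times V^h_3$ and $\underline V(\Gamma^m)=\{(\vec X_1,\vec X_2,\vec X_3)\in\underline V^h_1\times\underline V^h_2\times\underline V^h_3\mid\vec X_1=\vec X_2=\vec X_3\text{ on }\partial I=\{0,1\}\}$.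 The polygonal curves are $\Gamma^m_i=\vec X^m_i(I)\subset\Omega$ and $\Gamma^{m+1}_i=\vec X^{m+1}_i(I)$, with vertices $\vec q^m_{i,j}=\vec X^m_i(q_{i,j})$, $\vec q^{m+1}_{i,j}=\vec X^{m+1}_i(q_{i,j})$ and edges $e^m_{i,j}=[\vec q^m_{i,j-1},\vec q^m_{i,j}]$ of positive length $|e^m_{i,j}|$. $|\Gamma^m_i|=\sum_{j=1}^{N_i}|e^m_{i,j}|$ is the length of the polygonal curve, and similarly for $\Gamma^{m+1}_i$. Inner products. Functions on $\Gamma^m_i$ are identified with functions on $I$ via $\vec X^m_i$; bulk functions $\varphi\in S^m$ are restricted to $\Gamma^m_i$ (i.e. $\varphi\circ\vec X^m_i$). $\langle u,v\rangle_{\Gamma^m_i}=\int_{\Gamma^m_i}u\,v\,\mathrm d\mathcal H^1=\int_I u\,v\,|\partial_\rho\vec X^m_i|\,\mathrm d\rho$, and the mass-lumped product is $\langle u,v\rangle^h_{\Gamma^m_i}=\frac12\sum_{j=1}^{N_i}|e^m_{i,j}|\big((uv)(q_{i,j}^-)+(uv)(q_{i,j-1}^+)\big)$ with one-sided limits from within $[q_{i,j-1},q_{i,j}]$; both extend to vector- and tensor-valued functions with the Euclidean/Frobenius product. $\langle u,v\rangle^{(h)}_{\Gamma^m}=\sum_{i=1}^3\langle u_i,v_i\rangle^{(h)}_{\Gamma^m_i}$. $\langle\nabla\boldsymbol W,\nabla\boldsymbol\varphi\rangle_\Omega=\sum_{j=1}^3\int_\Omega\nabla W_j\cdot\nabla\varphi_j\,\mathrm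 d\mathcal L^2$ and $\|\nabla\boldsymbol W\|_2^2=\langle\nabla\boldsymbol W,\nabla\boldsymbol W\rangle_\Omega$. $\nabla_s$ is the arclength derivative on $\Gamma^m$, i.e. $\langle\sigma\nabla_s\vec X,\nabla_s\vec\eta\rangle_{\Gamma^m}=\sum_{i=1}^3\sigma_i\int_I\partial_\rho\vec X_i\cdot\partial_\rho\vec\eta_i\,|\partial_\rho\vec X^m_i|^{-1}\,\mathrm d\rho$. Time-averaged normals. For $t\in[t_m,t_{m+1}]$ let $\vec q^h_{i,j}(t)=\frac{t_{m+1}-t}{\tau_m}\vec q^m_{i,j}+\frac{t-t_m}{\tau_m}\vec q^{m+1}_{i,j}$, let $e^h_{i,j}(t)=[\vec q^h_{i,j-1}(t),\vec q^h_{i,j}(t)]$, and let $\vec\nu^h$ be the unit normal on it, so that $\vec\nu^h|e^h_{i,j}(t)|=(\vec q^h_{i,j}(t)-\vec q^h_{i,j-1}(t))^\perp$ with $\binom ab^\perp=\binom{-b}{a}$. Define $\vec\nu^{m+\frac12}_i=\frac1{\tau_m|e^m_{i,j}|}\int_{t_m}^{t_{m+1}}\vec\nu^h|e^h_{i,j}(t)|\,\mathrm dt$ on $e^m_{i,j}$, $1\le j\le N_i$, and define $\vec\omega^{m+\frac12}_i\in\underline V^h_i$ by $\langle\vec\omega^{m+\frac12}_i,\vec\xi\rangle^h_{\Gamma^m_i}=\langle\vec\nu^{m+\frac12}_i,\vec\xi\rangle_{\Gamma^m_i}$ for all $\vec\xi\in\underline V^h_i$; $\vec\omega^{m+\frac12}=(\vec\omega^{m+\frac12}_1,\vec\omega^{m+\frac12}_2,\vec\omega^{m+\frac12}_3)$.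 *)

(* Defs.v *)
From HB Require Import structures.
From mathcomp Require Import all_boot all_order all_algebra.
From mathcomp Require Import all_classical all_reals all_analysis.

Set Implicit Arguments.
Unset Strict Implicit.
Unset Printing Implicit Defensive.

Import Order.TTheory GRing.Theory Num.Theory.
Import numFieldNormedType.Exports.

Local Open Scope classical_set_scope.
Local Open Scope ring_scope.

(* R * R carries the library's sup norm, which only matters for its topology
   and for boundedness; Euclidean lengths are always taken with [enorm]. *)
Notation plane R := (R * R)%type.

Definition dotp (R : realType) (u v : plane R) : R := u.1 * v.1 + u.2 * v.2.

Definition enorm (R : realType) (u : plane R) : R := Num.sqrt (dotp u u).

Definition perp (R : realType) (u : plane R) : plane R := (- u.2, u.1).

Definition domain (R : realType) (Omega : set (plane R)) : Prop :=
  [/\ Omega !=set0, open Omega & connected Omega].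

(* The convex hull of the vertices v a with a in A. *)
Definition face (R : realType) (v : 'I_3 -> plane R) (A : set 'I_3) :
    set (plane R) :=
  [set p | exists l : 'I_3 -> R,
    [/\ forall a, 0 <= l a, \sum_a l a = 1, forall a, ~ A a -> l a = 0
      & p = \sum_a l a *: v a]].

Definition triangle (R : realType) (v : 'I_3 -> plane R) : set (plane R) :=
  face v setT.

Definition i1 : 'I_3 := @Ordinal 3 0 isT.
Definition i2 : 'I_3 := @Ordinal 3 1 isT.
Definition i3 : 'I_3 := @Ordinal 3 2 isT.

Definition nondegenerate (R : realType) (v : 'I_3 -> plane R) : Prop :=
  dotp (perp (v i2 - v i1)) (v i3 - v i1) != 0.

(* Finitely many closed nondegenerate triangles covering the closure of Omega;
   two distinct ones meet in the convex hull of their common vertices, i.e. in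
   nothing, a common vertex or a common edge. *)
Definition triangulation (R : realType) (Omega : set (plane R))
    (K : finType) (T : K -> 'I_3 -> plane R) : Prop :=
  [/\ forall k, nondegenerate (T k),
      \bigcup_(k in [set: K]) triangle (T k) = closure Omega
    & forall k k', k != k' ->
        triangle (T k) <> triangle (T k') /\
        triangle (T k) `&` triangle (T k') =
          face (T k) [set a | exists b, T k a = T k' b]].

(* Functions on the closure of Omega are represented by functions on the plane
   whose values outside of the closure are irrelevant. *)
Definition Sm (R : realType) (Omega : set (plane R)) (K : finType)
    (T : K -> 'I_3 -> plane R) : set (plane R -> R) :=
  [set v : plane R -> R | {within closure Omega, continuous v} /\
    forall k, exists (c : R) (g : plane R),
      forall p, triangle (T k) p -> v p = c + dotp g p].

Definition SmSigma (R : realType) (Omega : set (plane R)) (K : finType)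
    (T : K -> 'I_3 -> plane R) : set ('I_3 -> plane R -> R) :=
  [set phi | (forall i, Sm Omega T (phi i)) /\
    (forall p, closure Omega p -> phi i1 p + phi i2 p + phi i3 p = 0)].

Definition Lambda : seq ('I_3 * 'I_3 * 'I_3) :=
  [:: (i1, i3, i2); (i2, i1, i3); (i3, i2, i1)].

Definition grad (R : realType) (f : plane R -> R) (p : plane R) : plane R :=
  ('D_((1 : R), (0 : R)) f p, 'D_((0 : R), (1 : R)) f p).

(* Elements of Sm are differentiable in Omega off the edges of the
   triangulation, a null set. *)
Definition ip_grad (R : realType) (Omega : set (plane R))
    (W phi : 'I_3 -> plane R -> R) : R :=
  \sum_(j < 3)
    \int[(@lebesgue_measure R \x @lebesgue_measure R)%E]_(p in Omega)
      dotp (grad (W j) p) (grad (phi j) p).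

(* Nodes 0 = q 0 < ... < q N = 1; the values q j with j > N are irrelevant. *)
Definition grid (R : realType) (N : nat) (q : nat -> R) : Prop :=
  [/\ (2 <= N)%N, q 0%N = 0, q N = 1
    & forall j, (j < N)%N -> q j < q j.+1].

(* Functions on [0, 1] are represented by functions on R whose values outside
   of [0, 1] are irrelevant. *)
Definition Vh (R : realType) (N : nat) (q : nat -> R) : set (R -> R) :=
  [set v : R -> R | {within `[0, 1], continuous v} /\
    forall j, (j < N)%N -> exists a b : R,
      {in `[q j, q j.+1], forall rho, v rho = a + b * rho}].

Definition Vh2 (R : realType) (N : nat) (q : nat -> R) : set (R -> plane R) :=
  [set X | Vh N q (fun rho => (X rho).1) /\ Vh N q (fun rho => (X rho).2)].

Definition VGamma (R : realType) (N : 'I_3 -> nat) (q : 'I_3 -> nat -> R) :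
    set ('I_3 -> R -> R) :=
  [set v | forall i, Vh (N i) (q i) (v i)].

Definition VGamma2 (R : realType) (N : 'I_3 -> nat) (q : 'I_3 -> nat -> R) :
    set ('I_3 -> R -> plane R) :=
  [set X | (forall i, Vh2 (N i) (q i) (X i)) /\
    (forall i j, X i 0 = X j 0 /\ X i 1 = X j 1)].

(* On [q k, q k.+1] the summands with j < k equal f (q j.+1) - f (q j), those
   with j > k vanish, and the k-th one is affine. *)
Definition interp (R : realType) (N : nat) (q : nat -> R) (f : R -> R) :
    R -> R :=
  fun rho => f (q 0%N) + \sum_(j < N) (f (q j.+1) - f (q j)) *
    Num.max 0 (Num.min 1 ((rho - q j) / (q j.+1 - q j))).

Lemma grid_le (R : realType) (N : nat) (q : nat -> R) : grid N q ->
  forall j k, (j <= k <= N)%N -> q j <= q k.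
Proof.
case=> _ _ _ qlt j; elim=> [|k IHk]; first by case: j.
case/andP; rewrite leq_eqVlt => /predU1P[->//|jk kN].
by rewrite (le_trans (IHk _)) ?ltW ?qlt// -ltnS jk ltnW.
Qed.

Lemma interp_piece (R : realType) (N : nat) (q : nat -> R) (f : R -> R) :
  grid N q -> forall k rho, (k < N)%N -> q k <= rho <= q k.+1 ->
  interp N q f rho =
    f (q k) + (f (q k.+1) - f (q k)) * ((rho - q k) / (q k.+1 - q k)).
Proof.
move=> gq k rho kN /andP[qk1 qk2]; have [_ _ _ qlt] := gq.
have d0 j : (j < N)%N -> 0 < q j.+1 - q j by move=> jN; rewrite subr_gt0 qlt.
rewrite /interp.
pose c j := Num.max 0 (Num.min 1 ((rho - q j) / (q j.+1 - q j))).
rewrite -(big_mkord xpredT (fun j => (f (q j.+1) - f (q j)) * c j)).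
rewrite (@big_cat_nat _ _ _ k 0%N N) //=; last exact: ltnW.
rewrite (big_ltn kN).
have -> : \sum_(0 <= j < k) (f (q j.+1) - f (q j)) * c j =
          \sum_(0 <= j < k) (f (q j.+1) - f (q j)).
  apply: eq_big_nat.
  move=> j /= jk; have jN := ltn_trans jk kN.
  rewrite /c min_l ?max_r ?ler01 ?mulr1//.
  rewrite ler_pdivlMr ?d0// mul1r lerB// (le_trans _ qk1)//.
  by rewrite (grid_le gq)// jk ltnW.
rewrite telescope_sumr// [X in _ + (_ + (_ + X))]big_nat_cond big1 ?addr0.
  rewrite addrA subrKC /c max_r.
    rewrite min_r// ler_pdivrMr ?d0// mul1r lerB//.
  by rewrite le_min ler01 /= divr_ge0 ?subr_ge0// ltW ?qlt.
move=> j; rewrite andbT => /andP[kj jN].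
rewrite /c max_l ?mulr0// ge_min; apply/orP; right.
rewrite pmulr_lle0 ?invr_gt0 ?d0// subr_le0 (le_trans qk2)//.
by rewrite (grid_le gq)// kj ltnW.
Qed.

Lemma interp_node (R : realType) (N : nat) (q : nat -> R) (f : R -> R) :
  grid N q -> forall k, (k <= N)%N -> interp N q f (q k) = f (q k).
Proof.
move=> gq k; have [N2 _ _ qlt] := gq.
rewrite leq_eqVlt => /predU1P[->|kN].
  have [n En] : exists n, N = n.+1 by case: (N) N2 => // n; exists n.
  have nN : (n < N)%N by rewrite En.
  rewrite (interp_piece f gq nN) -En ?lexx ?andbT ?ltW ?divff ?mulr1 ?subrKC//.
  - by rewrite subr_eq0 gt_eqF// {1}En qlt.
  - by rewrite {1}En qlt.
by rewrite (interp_piece f gq kN) ?lexx ?ltW ?qlt// subrr mul0r mulr0 addr0.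
Qed.

Lemma interp_Vh (R : realType) (N : nat) (q : nat -> R) (f : R -> R) :
  grid N q -> Vh N q (interp N q f).
Proof.
move=> gq; split.
  apply: continuous_subspaceT => x; apply: cvgD; first exact: cvg_cst.
  apply: cvg_big => [|j _]; [exact: add_continuous|]; apply: cvgM; first exact: cvg_cst.
  pose g (y : R) := (y - q j) / (q j.+1 - q j).
  have cg : {for x, continuous g}.
    apply: cvgM; last exact: cvg_cst.
    by apply: cvgB; [exact: cvg_id|exact: cvg_cst].
  have c1 : {for x, continuous (cst (1 : R) \min g)}.
    by apply: continuous_min cg; exact: cvg_cst.
  have := @continuous_max _ _ (cst (0 : R)) _ x (cvg_cst _) c1.
  exact.
move=> k kN; set d := f (q k.+1) - f (q k); set h := q k.+1 - q k.
exists (f (q k) - d * (q k / h)), (d / h) => rho; rewrite in_itv /= => hr.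
rewrite (interp_piece f gq kN hr) -/d -/h; move: d h => d h.
by rewrite -mulrA (mulrC h^-1) -addrA (addrC (- _)) -mulrBr -mulrBl.
Qed.

(* The length of the (j+1)-st edge of the polygonal curve X. *)
Definition edge_len (R : realType) (q : nat -> R) (X : R -> plane R) (j : nat) :
    R :=
  enorm (X (q j.+1) - X (q j)).

Definition curve_len (R : realType) (N : nat) (q : nat -> R)
    (X : R -> plane R) : R :=
  \sum_(j < N) edge_len q X j.

Definition weighted_len (R : realType) (sigma : 'I_3 -> R) (N : 'I_3 -> nat)
    (q : 'I_3 -> nat -> R) (X : 'I_3 -> R -> plane R) : R :=
  \sum_i sigma i * curve_len (N i) (q i) (X i).

Definition int_exact (R : realType) (X : R -> plane R) (w : R -> R) : R :=
  \int[@lebesgue_measure R]_(rho in `[0, 1]) (w rho * enorm (derive1 X rho)).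

Definition int_lumped (R : realType) (N : nat) (q : nat -> R)
    (X : R -> plane R) (w : R -> R) : R :=
  2^-1 * \sum_(j < N) edge_len q X j *
    (lim (w rho @[rho --> (q j.+1)^'-]) + lim (w rho @[rho --> (q j)^'+])).

(* The products over the curve X; the mass-lumped ones are those with
   [lump = true]. *)
Definition ip (R : realType) (lump : bool) (N : nat) (q : nat -> R)
    (X : R -> plane R) (u v : R -> R) : R :=
  let w rho := u rho * v rho in
  if lump then int_lumped N q X w else int_exact X w.

Definition ip2 (R : realType) (lump : bool) (N : nat) (q : nat -> R)
    (X : R -> plane R) (u v : R -> plane R) : R :=
  let w rho := dotp (u rho) (v rho) in
  if lump then int_lumped N q X w else int_exact X w.

Definition ipGamma (R : realType) (lump : bool) (N : 'I_3 -> nat)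
    (q : 'I_3 -> nat -> R) (X : 'I_3 -> R -> plane R) (u v : 'I_3 -> R -> R) :
    R :=
  \sum_i ip lump (N i) (q i) (X i) (u i) (v i).

Definition ip2Gamma (R : realType) (lump : bool) (N : 'I_3 -> nat)
    (q : 'I_3 -> nat -> R) (X : 'I_3 -> R -> plane R)
    (u v : 'I_3 -> R -> plane R) : R :=
  \sum_i ip2 lump (N i) (q i) (X i) (u i) (v i).

(* The sigma-weighted product of the arclength derivatives of Y and eta on the
   curves X. *)
Definition ip_ds (R : realType) (sigma : 'I_3 -> R)
    (X Y eta : 'I_3 -> R -> plane R) : R :=
  \sum_i sigma i * \int[@lebesgue_measure R]_(rho in `[0, 1])
    (dotp (derive1 (Y i) rho) (derive1 (eta i) rho) *
     (enorm (derive1 (X i) rho))^-1).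

Definition unit_normal (R : realType) (a b : plane R) : plane R :=
  (enorm (b - a))^-1 *: perp (b - a).

Definition moving_point (R : realType) (t0 t1 : R) (p0 p1 : plane R) (t : R) :
    plane R :=
  ((t1 - t) / (t1 - t0)) *: p0 + ((t - t0) / (t1 - t0)) *: p1.

(* When the moving edge degenerates to a point at time t, the integrand is 0,
   since 0^-1 = 0. *)
Definition nu_edge (R : realType) (t0 t1 : R) (q : nat -> R)
    (X0 X1 : R -> plane R) (j : nat) : plane R :=
  let a := moving_point t0 t1 (X0 (q j)) (X1 (q j)) in
  let b := moving_point t0 t1 (X0 (q j.+1)) (X1 (q j.+1)) in
  let n t := enorm (b t - a t) *: unit_normal (a t) (b t) in
  ((t1 - t0) * edge_len q X0 j)^-1 *:
    (\int[@lebesgue_measure R]_(t in `[t0, t1]) (n t).1,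
     \int[@lebesgue_measure R]_(t in `[t0, t1]) (n t).2).

(* Piecewise constant; the values at the nodes do not affect the integrals in
   which it occurs. *)
Definition nu_half (R : realType) (t0 t1 : R) (N : nat) (q : nat -> R)
    (X0 X1 : R -> plane R) (rho : R) : plane R :=
  \sum_(j < N | q j < rho < q j.+1) nu_edge t0 t1 q X0 X1 j.

Definition is_omega_half (R : realType) (t0 t1 : R) (N : nat) (q : nat -> R)
    (X0 X1 : R -> plane R) (omega : R -> plane R) : Prop :=
  Vh2 N q omega /\
  forall xi, Vh2 N q xi ->
    ip2 true N q X0 omega xi = ip2 false N q X0 (nu_half t0 t1 N q X0 X1) xi.

(* Main.v *)
Require Import Defs.
From HB Require Import structures.
From mathcomp Require Import all_boot all_order all_algebra.
From mathcomp Require Import all_classical all_reals all_analysis.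
From mathcomp Require Import measurable_realfun ring lra.

Set Implicit Arguments.
Unset Strict Implicit.
Unset Printing Implicit Defensive.

Import Order.TTheory GRing.Theory Num.Theory.
Import numFieldNormedType.Exports.

Local Open Scope classical_set_scope.
Local Open Scope ring_scope.

(** Test the first equation with W itself and the second one with the
    interpolants V_i of the discrete normal velocities.  The exchange terms of
    the two are the same, lumped or not, so that
      ip_grad W W = sum_i <kappa_i, V_i>^h.
    A lumped product only sees the values at the nodes, where V_i coincides
    with the function that it interpolates; hence tau times the right-hand side
    is <kappa omega, X - Xm>^h ([lumped_velocity_ip]).  The third equation, tested with the displacement
    X - Xm, turns this into - ip_ds sigma Xm X (X - Xm), so everything reduces to
      |Gamma^(m+1)|_sigma - |Gamma^m|_sigma <= ip_ds sigma Xm X (X - Xm).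
    The derivatives in ip_ds are constant on each grid interval, so the integral
    is a sum over the edges ([ip_ds_term]), and the claim follows edge by edge
    from |e| - |e0| <= e . (e - e0) / |e0| ([edge_convexity]). *)

(** * Euclidean geometry of the plane *)

Section Plane.
Variable R : realType.
Implicit Types (u v : plane R) (a : R).

Lemma dotp_ge0 u : 0 <= dotp u u.
Proof. by rewrite /dotp -!expr2 addr_ge0 ?sqr_ge0. Qed.

Lemma sqr_enorm u : enorm u ^+ 2 = dotp u u.
Proof. by rewrite sqr_sqrtr ?dotp_ge0. Qed.

Lemma dotpZl a u v : dotp (a *: u) v = a * dotp u v.
Proof. by rewrite /dotp -[_.1]/(a * u.1) -[_.2]/(a * u.2) mulrDr !mulrA. Qed.

Lemma dotpC u v : dotp u v = dotp v u.
Proof. by rewrite /dotp mulrC [u.2 * _]mulrC. Qed.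

Lemma dotpZr a u v : dotp u (a *: v) = a * dotp u v.
Proof. by rewrite dotpC dotpZl dotpC. Qed.

Lemma dotpBr u v w : dotp u (v - w) = dotp u v - dotp u w.
Proof. by rewrite /dotp /=; ring. Qed.

Lemma enormZ a u : 0 <= a -> enorm (a *: u) = a * enorm u.
Proof.
move=> a0; rewrite /enorm dotpZl dotpZr mulrA sqrtrM ?mulr_ge0//.
by rewrite -expr2 sqrtr_sqr ger0_norm.
Qed.

Lemma dotp_le_enorm u v : dotp u v <= enorm u * enorm v.
Proof.
rewrite -sqrtrM ?dotp_ge0//; apply: le_trans (ler_norm _) _.
rewrite -sqrtr_sqr ler_wsqrtr// -subr_ge0.
(* the defect in the Cauchy-Schwarz inequality is a squared determinant *)
have -> : dotp u u * dotp v v - dotp u v ^+ 2 = (u.1 * v.2 - u.2 * v.1) ^+ 2.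
  by rewrite /dotp; ring.
exact: sqr_ge0.
Qed.

(** By Cauchy-Schwarz the right-hand side is at least
    |e| (|e| - |e0|) / |e0|, which exceeds the left-hand side by
    (|e| - |e0|)^2 / |e0|. *)
Lemma edge_convexity (e e0 : plane R) : 0 < enorm e0 ->
  enorm e - enorm e0 <= dotp e (e - e0) / enorm e0.
Proof.
move=> e0_gt0; rewrite ler_pdivlMr// dotpBr -sqr_enorm.
have := dotp_le_enorm e e0; have := sqr_ge0 (enorm e - enorm e0).
by nra.
Qed.

End Plane.

(** * Piecewise affine functions on a grid *)

Section Grid.
Variables (R : realType) (N : nat) (q : nat -> R).
Implicit Types (v w f : R -> R) (X Y : R -> plane R).

(** The integrands of the lumped products are products of elements of [Vh],
    which leave [Vh] but keep this property; it suffices to evaluate the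
    one-sided limits in [int_lumped]. *)
Definition node_continuous w :=
  forall j, (j < N)%N ->
    w rho @[rho --> (q j)^'+] --> w (q j) /\
    w rho @[rho --> (q j.+1)^'-] --> w (q j.+1).

Lemma node_continuousD v w : node_continuous v -> node_continuous w ->
  node_continuous (fun rho => v rho + w rho).
Proof.
by move=> cv cw j jN; have [? ?] := cv j jN; have [? ?] := cw j jN; split;
  exact: cvgD.
Qed.

Lemma node_continuousM v w : node_continuous v -> node_continuous w ->
  node_continuous (fun rho => v rho * w rho).
Proof.
by move=> cv cw j jN; have [? ?] := cv j jN; have [? ?] := cw j jN; split;
  exact: cvgM.
Qed.

Lemma int_lumpedE X w : node_continuous w ->
  int_lumped N q X w =
    2^-1 * \sum_(j < N) edge_len q X j * (w (q j.+1) + w (q j)).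
Proof.
move=> cw; congr (_ * _); apply: eq_bigr => j _; have [cr cl] := cw j (ltn_ord j).
by congr (_ * (_ + _)); exact: cvg_lim.
Qed.

Hypothesis gq : grid N q.

Lemma grid_lt j : (j < N)%N -> q j < q j.+1.
Proof. by case: gq => _ _ _; exact. Qed.

Lemma Vh_node_continuous v : Vh N q v -> node_continuous v.
Proof.
case=> _ vaff j jN; have [a [b vE]] := vaff j jN; have qj := grid_lt jN.
have aff x : a + b * rho @[rho --> x] --> a + b * x.
  by apply: cvgD; [exact: cvg_cst|apply: cvgM; [exact: cvg_cst|exact: cvg_id]].
split.
- rewrite vE ?in_itv/= ?lexx ?ltW//.
  apply: cvg_trans (cvg_at_right_filter (aff _)); apply: near_eq_cvg.
  near=> rho; rewrite /= vE// in_itv/=; apply/andP; split; apply: ltW.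
    by near: rho; exact: nbhs_right_gt.
  by near: rho; exact: nbhs_right_lt.
- rewrite vE ?in_itv/= ?lexx ?ltW//.
  apply: cvg_trans (cvg_at_left_filter (aff _)); apply: near_eq_cvg.
  near=> rho; rewrite /= vE// in_itv/=; apply/andP; split; apply: ltW.
    by near: rho; exact: nbhs_left_gt.
  by near: rho; exact: nbhs_left_lt.
Unshelve. all: by end_near. Qed.

Lemma Vh2_dotp_node_continuous X Y : Vh2 N q X -> Vh2 N q Y ->
  node_continuous (fun rho => dotp (X rho) (Y rho)).
Proof.
by move=> [X1 X2] [Y1 Y2]; apply: node_continuousD; apply: node_continuousM;
  exact: Vh_node_continuous.
Qed.

Lemma VhB v w : Vh N q v -> Vh N q w -> Vh N q (fun rho => v rho - w rho).
Proof.
move=> [cv va] [cw wa]; split; first by move=> x; apply: cvgB; [exact: cv|exact: cw].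
move=> j jN; have [a [b vE]] := va j jN; have [c [d wE]] := wa j jN.
by exists (a - c), (b - d) => rho hrho; rewrite vE// wE//; ring.
Qed.

Lemma Vh2B X Y : Vh2 N q X -> Vh2 N q Y -> Vh2 N q (fun rho => X rho - Y rho).
Proof. by move=> [X1 X2] [Y1 Y2]; split; exact: VhB. Qed.

(** Lumping samples the integrand at the nodes, where the interpolant agrees
    with f. *)
Lemma int_lumped_interp X v f :
  Vh N q v -> node_continuous f ->
  int_lumped N q X (fun rho => v rho * interp N q f rho) =
  int_lumped N q X (fun rho => v rho * f rho).
Proof.
move=> /Vh_node_continuous cv cf.
rewrite !int_lumpedE; [|exact: node_continuousM|].
  congr (_ * _); apply: eq_bigr => j _.
  by rewrite !(interp_node _ gq)// ltnW.
by apply: node_continuousM => //; exact/Vh_node_continuous/interp_Vh.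
Qed.

Lemma Vh2_derive1 X j rho : Vh2 N q X -> (j < N)%N -> q j < rho < q j.+1 ->
  derive1 X rho = (q j.+1 - q j)^-1 *: (X (q j.+1) - X (q j)).
Proof.
move=> [[_ X1] [_ X2]] jN hrho; have qj := grid_lt jN.
have [a [b E1]] := X1 j jN; have [c [d E2]] := X2 j jN.
have XE r : q j <= r <= q j.+1 -> X r = (a, c) + r *: (b, d).
  move=> hr; rewrite [LHS]surjective_pairing E1 ?E2 ?in_itv//.
  by congr pair; rewrite /= mulrC.
rewrite !XE ?lexx ?ltW// opprD addrACA subrr add0r -scalerBl scalerA.
rewrite mulVf ?subr_eq0 ?gt_eqF// scale1r derive1E.
have XEnear : \forall r \near rho, (a, c) + r *: (b, d) = X r.
  near=> r; rewrite XE//.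
  have : r \in `](q j), (q j.+1)[ by near: r; apply: near_in_itvoo; rewrite in_itv.
  by rewrite in_itv/= => /andP[? ?]; rewrite !ltW.
rewrite -(near_eq_derive _ XEnear); apply: cvg_lim => //.
apply: cvg_near_cst; apply: filterS (nbhs_dnbhs_neq (0 : R)) => h h0.
rewrite /= opprD addrACA subrr add0r -scalerBl addrK scalerA.
by rewrite [_%:A]mulr1 mulVf// scale1r.
Unshelve. all: by end_near. Qed.

End Grid.

(** * Integrals of arclength derivatives *)

Section Integral.
Variables (R : realType) (N : nat) (q : nat -> R).
Hypothesis gq : grid N q.
Local Notation mu := (@lebesgue_measure R).

(** Additivity of the integral over the closed intervals needs measurability on
    the whole of [0, 1], where the values at the nodes are arbitrary; the
    induction therefore carries both facts. *)
Lemma Rintegral_piecewise_cst (f : R -> R) (c : nat -> R) :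
  (forall j, (j < N)%N -> forall rho, q j < rho < q j.+1 -> f rho = c j) ->
  \int[mu]_(rho in `[0, 1]) f rho = \sum_(j < N) c j * (q j.+1 - q j).
Proof.
move=> fE; have [_ q0 qN _] := gq.
have mf j : (j < N)%N -> measurable_fun `](q j), (q j.+1)[ f.
  move=> jN; apply: (eq_measurable_fun (cst (c j))) => //.
  by move=> x; rewrite inE/= in_itv/= => hx; rewrite /= (fE j).
suff /(_ N (leqnn _))[_] : forall k, (k <= N)%N ->
    measurable_fun `[q 0%N, q k] f /\
    (\int[mu]_(rho in `[q 0%N, q k]) (f rho)%:E =
     (\sum_(j < k) c j * (q j.+1 - q j))%:E)%E.
  by rewrite q0 qN /Rintegral => ->.
elim=> [_|k IHk kN].
  by rewrite set_itv1 integral_set1 big_ord0; split => //; exact: measurable_fun_set1.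
have [mk Ek] := IHk (ltnW kN).
have q0k : q 0%N <= q k by apply: (grid_le gq); exact: ltnW.
have qk := grid_lt gq kN.
have mk1 : measurable_fun `](q k), (q k.+1)] f.
  by apply/measurable_fun_itv_bndo_bndcP; exact: mf.
have U : `[q 0%N, q k.+1]%classic = `[q 0%N, q k] `|` `](q k), (q k.+1)].
  by rewrite -itv_bndbnd_setU// bnd_simp// ltW.
have mU : measurable_fun `[q 0%N, q k.+1] f by rewrite U; apply/measurable_funU.
split => //; rewrite U integral_setU//=; last 2 first.
- by rewrite -U; exact/measurable_EFinP.
- apply/disj_setPS => x [] /=; rewrite !in_itv/= => /andP[_ xk] /andP[kx _].
  by rewrite ltNge xk in kx.
rewrite Ek big_ord_recr/= EFinD; congr (_ + _)%E.
rewrite integral_itv_bndoo; last by apply/measurable_EFinP; exact: mf.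
rewrite (eq_integral (cst (c k)%:E)); last first.
  by move=> x; rewrite inE/= in_itv/= => hx; rewrite (fE k).
by rewrite integral_cst//= lebesgue_measure_itv/= lte_fin qk -EFinB -EFinM.
Qed.

(** With h = q j.+1 - q j, the three slopes contribute h^-1 h^-1 (h^-1)^-1 and
    the interval contributes h, so the grid drops out. *)
Lemma ip_ds_term (X0 X1 X2 : R -> plane R) :
  Vh2 N q X0 -> Vh2 N q X1 -> Vh2 N q X2 ->
  \int[mu]_(rho in `[0, 1])
    (dotp (derive1 X1 rho) (derive1 X2 rho) * (enorm (derive1 X0 rho))^-1) =
  \sum_(j < N) dotp (X1 (q j.+1) - X1 (q j)) (X2 (q j.+1) - X2 (q j)) /
    edge_len q X0 j.
Proof.
move=> hX0 hX1 hX2.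
rewrite (@Rintegral_piecewise_cst _ (fun j => (q j.+1 - q j)^-1 *
  (dotp (X1 (q j.+1) - X1 (q j)) (X2 (q j.+1) - X2 (q j)) / edge_len q X0 j))).
  apply: eq_bigr => j _; rewrite mulrAC mulVf ?mul1r//.
  by rewrite subr_eq0 gt_eqF// (grid_lt gq).
move=> j jN rho hrho; rewrite !(Vh2_derive1 gq _ jN hrho)//.
have h0 : 0 < q j.+1 - q j by rewrite subr_gt0 (grid_lt gq).
rewrite dotpZl dotpZr enormZ ?invr_ge0 ?ltW// -/(edge_len q X0 j) invfM invrK.
by move: (dotp _ _) (edge_len q X0 j)^-1 => d l; field; rewrite gt_eqF.
Qed.

Lemma curve_len_variation (X0 X1 : R -> plane R) :
  Vh2 N q X0 -> Vh2 N q X1 ->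
  (forall j, (j < N)%N -> 0 < edge_len q X0 j) ->
  curve_len N q X1 - curve_len N q X0 <=
  \int[mu]_(rho in `[0, 1])
    (dotp (derive1 X1 rho) (derive1 (fun r => X1 r - X0 r) rho) *
     (enorm (derive1 X0 rho))^-1).
Proof.
move=> hX0 hX1 len0; rewrite ip_ds_term//; last exact: Vh2B.
rewrite -sumrB; apply: ler_sum => j _.
have -> : X1 (q j.+1) - X0 (q j.+1) - (X1 (q j) - X0 (q j)) =
          X1 (q j.+1) - X1 (q j) - (X0 (q j.+1) - X0 (q j)).
  by rewrite !opprB addrACA [- _ - _]addrC addrACA.
exact/edge_convexity/len0.
Qed.

End Integral.

(** * The energy estimate *)

Section Energy.
Variable R : realType.

Lemma ipC lump N q X (u v : R -> R) : ip lump N q X u v = ip lump N q X v u.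
Proof.
rewrite /ip; suff -> : (fun rho => u rho * v rho) = (fun rho => v rho * u rho) by [].
by apply/funext => rho; rewrite mulrC.
Qed.

Lemma weighted_len_variation (sigma : 'I_3 -> R) (N : 'I_3 -> nat)
    (q : 'I_3 -> nat -> R) (X0 X1 : 'I_3 -> R -> plane R) :
  (forall i, 0 <= sigma i) -> (forall i, grid (N i) (q i)) ->
  VGamma2 N q X0 -> VGamma2 N q X1 ->
  (forall i j, (j < N i)%N -> 0 < edge_len (q i) (X0 i) j) ->
  weighted_len sigma N q X1 - weighted_len sigma N q X0 <=
  ip_ds sigma X0 X1 (fun i rho => X1 i rho - X0 i rho).
Proof.
move=> sigma0 gq [hX0 _] [hX1 _] len0; rewrite -sumrB; apply: ler_sum => i _.
rewrite -mulrBr ler_wpM2l//; apply: (curve_len_variation (gq i)) => //.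
exact: len0.
Qed.

Lemma VGamma2B (N : 'I_3 -> nat) (q : 'I_3 -> nat -> R)
    (X0 X1 : 'I_3 -> R -> plane R) :
  VGamma2 N q X0 -> VGamma2 N q X1 ->
  VGamma2 N q (fun i rho => X1 i rho - X0 i rho).
Proof.
move=> [h0 e0] [h1 e1]; split=> [i|i j]; first exact: Vh2B.
by have [-> ->] := e0 i j; have [-> ->] := e1 i j.
Qed.

(** The factor tau cancels the one in the discrete velocity, and the curvature,
    being scalar, moves from the velocity to the normal. *)
Lemma lumped_velocity_ip N q (X0 Y omega : R -> plane R) (kappa : R -> R)
    (tau : R) : tau != 0 -> grid N q -> Vh N q kappa -> Vh2 N q omega ->
  Vh2 N q Y ->
  tau * ip true N q X0 kappa
    (interp N q (fun rho => dotp (tau^-1 *: Y rho) (omega rho))) =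
  ip2 true N q X0 (fun rho => kappa rho *: omega rho) Y.
Proof.
move=> tau0 gq hkappa homega hY.
have cYo := Vh2_dotp_node_continuous gq hY homega.
have ck := Vh_node_continuous gq hkappa.
have eV : (fun rho => dotp (tau^-1 *: Y rho) (omega rho)) =
          (fun rho => cst tau^-1 rho * dotp (Y rho) (omega rho)).
  by apply/funext => rho; rewrite dotpZl.
have cV : node_continuous N q (fun rho => dotp (tau^-1 *: Y rho) (omega rho)).
  rewrite eV; apply: node_continuousM => //.
  by move=> j _; split; exact: cvg_cst.
rewrite /ip /ip2 int_lumped_interp//.
have -> : (fun rho => dotp (kappa rho *: omega rho) (Y rho)) =
          (fun rho => kappa rho * dotp (Y rho) (omega rho)).
  by apply/funext => rho; rewrite dotpZl dotpC.
rewrite !int_lumpedE; [|exact: node_continuousM..].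
rewrite mulrCA; congr (_ * _); rewrite mulr_sumr; apply: eq_bigr => j _.
by rewrite !dotpZl; field.
Qed.

End Energy.

Theorem theorem6p3 (R : realType)
  (Omega : set (plane R)) (K : finType) (T : K -> 'I_3 -> plane R)
  (t : nat -> R) (m : nat) (sigma : 'I_3 -> R)
  (N : 'I_3 -> nat) (q : 'I_3 -> nat -> R)
  (Xm : 'I_3 -> R -> plane R) (kappam : 'I_3 -> R -> R)
  (W : 'I_3 -> plane R -> R)
  (X : 'I_3 -> R -> plane R) (kappa : 'I_3 -> R -> R)
  (omega : 'I_3 -> R -> plane R) (lump : bool) :
  domain Omega -> bounded_set Omega -> triangulation Omega T ->
  0 < t m.+1 - t m ->
  (forall i, 0 < sigma i) ->
  sigma i1 <= sigma i2 + sigma i3 ->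
  sigma i2 <= sigma i1 + sigma i3 ->
  sigma i3 <= sigma i1 + sigma i2 ->
  (forall i, grid (N i) (q i)) ->
  VGamma2 N q Xm -> VGamma N q kappam ->
  (forall i, Xm i @` `[0, 1] `<=` Omega) ->
  (forall i j, (j < N i)%N -> 0 < edge_len (q i) (Xm i) j) ->
  SmSigma Omega T W -> VGamma2 N q X -> VGamma N q kappa ->
  (forall i,
     is_omega_half (t m) (t m.+1) (N i) (q i) (Xm i) (X i) (omega i)) ->
  (forall phi, SmSigma Omega T phi ->
     ip_grad Omega W phi -
     \sum_(l <- Lambda) (let: (i, j, k) := l in
       ip lump (N i) (q i) (Xm i)
         (interp (N i) (q i) (fun rho =>
            dotp ((t m.+1 - t m)^-1 *: (X i rho - Xm i rho)) (omega i rho)))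
         (fun rho => phi j (Xm i rho) - phi k (Xm i rho))) = 0) ->
  (forall xi, VGamma N q xi ->
     ipGamma true N q Xm kappa xi -
     \sum_(l <- Lambda) (let: (i, j, k) := l in
       ip lump (N i) (q i) (Xm i)
         (fun rho => W j (Xm i rho) - W k (Xm i rho)) (xi i)) = 0) ->
  (forall eta, VGamma2 N q eta ->
     ip2Gamma true N q Xm (fun i rho => kappa i rho *: omega i rho) eta +
     ip_ds sigma Xm X eta = 0) ->
  weighted_len sigma N q X + (t m.+1 - t m) * ip_grad Omega W W
    <= weighted_len sigma N q Xm.
Proof.
move=> _ _ _ tau0 sigma0 _ _ _ gq hXm _ _ len0 hW hX hkappa homega eqW eqk eqX.
set tau := t m.+1 - t m in tau0 eqW *.
pose Y i rho := X i rho - Xm i rho.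
pose V i := interp (N i) (q i)
  (fun rho => dotp (tau^-1 *: Y i rho) (omega i rho)).
have hY : VGamma2 N q Y by exact: VGamma2B.
have dissip : ip_grad Omega W W = ipGamma true N q Xm kappa V.
  have := eqW W hW; have /eqk : VGamma N q V by move=> i; exact: interp_Vh.
  move=> /subr0_eq -> /subr0_eq ->.
  by apply: eq_bigr => -[[i j] k] _; rewrite ipC.
have power : tau * ip_grad Omega W W = - ip_ds sigma Xm X Y.
  rewrite -(addr0_eq (eqX Y hY)) opprK dissip mulr_sumr; apply: eq_bigr => i _.
  apply: lumped_velocity_ip; rewrite ?gt_eqF//; first exact: (homega i).1.
  exact: hY.1.
rewrite power lerBlDr -lerBlDl.
by apply: weighted_len_variation => // i; exact/ltW/sigma0.
Qed.
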